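(* Let $m>1$ and let $\Omega\subset\mathbb{R}^m$ be a bounded open set with boundary of class $C^0$. There exist a neighbourhood $U$ of $\partial\Omega$ and a smooth function $G:U\to\mathbb{S}^{m-1}$ such that for each $P\in U$ the unit vector $G(P)$ is a good direction at $P$.
   Context: An open set $\Omega\subset\mathbb{R}^m$ has boundary of class $C^0$ if for every $P\in\partial\Omega$ there exist $\delta>0$, an orthonormal coordinate system $y=(y',y_m)$ with origin at $P$, and a continuous function $f:\mathbb{R}^{m-1}\to\mathbb{R}$ such that $\Omega\cap B(P,\delta)=\{y\in\mathbb{R}^m:y_m>f(y'),\ |y|<\delta\}$. Good direction: for a point $P\in\mathbb{R}^m$ (not necessarily on $\partial\Omega$) and $\delta>0$ with $B(P,\delta)\cap\partial\Omega\neq\emptyset$, a vector $n\in\mathbb{S}^{m-1}$ is a good direction at $P$ with respect to the ball $B(P,\delta)$ if there are an orthonormal coordinate system $y=(y',y_m)$ with origin at $P$ such that $n=e_m$ is the unit vector in the $y_m$ direction, and a continuous function $f:\mathbb{R}^{m-1}\to\mathbb{R}$ (depending on $P,n,\delta$), such that $\Omega\cap B(P,\delta)=\{y\in\mathbb{R}^m:y_m>f(y'),\ |y|<\delta\}$. The vector $n$ is a good direction at $P$ if it is a good direction at $P$ with respect to some ball $B(P,\delta)$ with $B(P,\delta)\cap\partial\Omega\ne\emptyset$. *)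

(* Defs.v *)
From HB Require Import structures.
From mathcomp Require Import all_boot all_order all_algebra.
From mathcomp Require Import all_classical all_reals all_analysis.
Set Implicit Arguments.
Unset Strict Implicit.
Unset Printing Implicit Defensive.
Import Order.TTheory GRing.Theory Num.Theory numFieldNormedType.Exports.
Local Open Scope classical_set_scope.
Local Open Scope ring_scope.

(* The canonical norm on ['rV[R]_n] is the sup norm. It is only used here
   through notions (open, closure, bounded, continuous, differentiable) that
   do not depend on the choice of a norm; balls, unit vectors and
   orthonormality are Euclidean. *)

Definition enorm (R : realType) (n : nat) (x : 'rV[R]_n) : R :=
  Num.sqrt (\sum_(i < n) x ord0 i ^+ 2).

Definition eball (R : realType) (n : nat) (P : 'rV[R]_n) (delta : R) :
    set 'rV[R]_n :=
  [set x | enorm (x - P) < delta].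

Definition unit_sphere (R : realType) (n : nat) : set 'rV[R]_n :=
  [set x | enorm x = 1].

Definition boundary (T : topologicalType) (A : set T) : set T :=
  closure A `\` interior A.

(* The rows of [Q] are the basis vectors e_1, ..., e_n. *)
Definition orthonormal_frame (R : realType) (n : nat) (Q : 'M[R]_n) : Prop :=
  Q *m Q^T = 1%:M.

(* In the frame [Q] with origin [P], the row [y] of coordinates denotes the
   point [P + y *m Q]; the ambient space is R^(m+1), [col' ord_max y : 'rV_m]
   is y' and [y ord0 ord_max] is the last coordinate. *)
Definition local_epigraph (R : realType) (m : nat) (Omega : set 'rV[R]_m.+1)
    (P : 'rV[R]_m.+1) (delta : R) (Q : 'M[R]_m.+1) (f : 'rV[R]_m -> R) : Prop :=
  Omega `&` eball P delta =
  [set P + y *m Q | y in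
    [set y : 'rV[R]_m.+1 | f (col' ord_max y) < y ord0 ord_max
                           /\ enorm y < delta]].

Definition C0_boundary (R : realType) (m : nat) (Omega : set 'rV[R]_m.+1) :
    Prop :=
  forall P, boundary Omega P ->
    exists (delta : R) (Q : 'M[R]_m.+1) (f : 'rV[R]_m -> R),
      [/\ 0 < delta, orthonormal_frame Q, continuous f
        & local_epigraph Omega P delta Q f].

Definition good_direction_wrt (R : realType) (m : nat)
    (Omega : set 'rV[R]_m.+1) (P : 'rV[R]_m.+1) (delta : R)
    (n : 'rV[R]_m.+1) : Prop :=
  unit_sphere n /\
  exists (Q : 'M[R]_m.+1) (f : 'rV[R]_m -> R),
    [/\ orthonormal_frame Q, row ord_max Q = n, continuous f
      & local_epigraph Omega P delta Q f].

Definition good_direction (R : realType) (m : nat)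
    (Omega : set 'rV[R]_m.+1) (P n : 'rV[R]_m.+1) : Prop :=
  exists delta : R,
    [/\ 0 < delta, eball P delta `&` boundary Omega !=set0
      & good_direction_wrt Omega P delta n].

(* Meant for [U] open: the derivatives at points of [U] then depend only on
   the restriction of [F] to [U]. *)
Fixpoint class_C (R : realType) (n p : nat) (k : nat) (U : set 'rV[R]_n)
    (F : 'rV[R]_n -> 'rV[R]_p) : Prop :=
  match k with
  | 0%N => forall x, U x -> {for x, continuous F}
  | k'.+1 => (forall x, U x -> differentiable F x) /\
             (forall v : 'rV[R]_n, class_C k' U ('D_v F))
  end.

Definition smooth_on (R : realType) (n p : nat) (U : set 'rV[R]_n)
    (F : 'rV[R]_n -> 'rV[R]_p) : Prop :=
  forall k : nat, class_C k U F.

(* Main.v *)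
Require Import Defs.
From mathcomp Require Import all_boot all_order all_algebra.
From mathcomp Require Import all_classical all_reals all_analysis.
From mathcomp Require Import finmap ring lra.
Import Order.TTheory GRing.Theory Num.Theory numFieldNormedType.Exports.
Local Open Scope classical_set_scope.
Local Open Scope ring_scope.
Set Implicit Arguments.
Unset Strict Implicit.
Unset Printing Implicit Defensive.

(* A unit vector n is a good direction with respect to a ball B as soon as
   moving from [closure Omega] along n inside B leads into Omega; the graph is
   then the infimum of the vertical sections of Omega, clamped to B. The vectors
   with this property form a convex cone, which does not contain 0 when B meets
   the boundary. Hence local good directions can be averaged by a smooth
   partition subordinate to a finite cover of the boundary by balls, and the
   average can be normalised. *)

(** * Smooth functions *)

(** Good directions come with their own frames and graphs, which cannot be added; [upward] mentions
    neither, so two directions can be compared on the same ball. The obstacle to convexity is that a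
    move along one summand may leave the ball although the move along the sum does not. To add local
    directions at a point, all of them must be upward on one ball centred there: the cover therefore
    uses half radii, and [e] is a common lower bound of these. The weights are bumps left undivided
    by their sum, since the final normalisation absorbs any positive factor. As [smooth_on] speaks
    of all iterated directional derivatives, the bumps are taken from a family closed under
    derivation. *)

Lemma near_eq_differentiable (R : realType) (V W : normedModType R)
    (f g : V -> W) (x : V) :
  (\forall y \near x, f y = g y) -> differentiable f x -> differentiable g x.
Proof.
move=> fg /diff_locallyP[dfc dfo].
have gE : g \o shift x = cst (g x) + 'd f x +o_ 0 id.
  apply/eqaddoP => e e0; move/eqaddoP : dfo => /(_ e e0) dfo.
  have fg0 : \forall h \near 0, f (h + x) = g (h + x).
    by move: fg; rewrite (near_shift 0 x) subr0.
  near=> h.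
  have -> : (g \o shift x - (cst (g x) + 'd f x)) h =
            (f \o shift x - (cst (f x) + 'd f x)) h.
    rewrite !fctE /=; have <- : f (h + x) = g (h + x) by near: h.
    by rewrite (nbhs_singleton fg).
  by near: h.
apply/diff_locallyP.
have -> : 'd g x = 'd f x :> (V -> W) by exact: diff_unique.
by [].
Unshelve. all: by end_near. Qed.

Lemma differentiable_comp_real (R : realType) (V : normedModType R)
    (f : V -> R) (h : R -> R) (l : R) (x : V) :
  differentiable f x -> is_derive (f x) 1 h l -> differentiable (h \o f) x.
Proof.
by move=> df [/derivable1_diffP dh _]; exact: differentiable_comp.
Qed.

Lemma derive_comp_real (R : realType) (V : normedModType R)
    (f : V -> R) (h : R -> R) (l : R) (x v : V) :
  differentiable f x -> is_derive (f x) 1 h l ->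
  'D_v (h \o f) x = l * 'D_v f x.
Proof.
move=> df dh; have dhf := differentiable_comp_real df dh.
have dhx : differentiable h (f x) by case: dh => /derivable1_diffP.
rewrite !deriveE// diff_comp//=; case: dh => dh' <-.
by rewrite deriv1E// derive1E mulrC.
Qed.

Section flat_functions.
Context {R : realType}.

(** The classical flat function [exp (-1/s)], multiplied by a power of [1/s] so that derivatives are
    combinations of members of the same family. *)
Definition flat (n : nat) (s : R) : R :=
  if 0 < s then s^-1 ^+ n * expR (- s^-1) else 0.

Lemma flat_gt0 n s : 0 < s -> 0 < flat n s.
Proof. by move=> s0; rewrite /flat s0 mulr_gt0 ?expR_gt0 ?exprn_gt0 ?invr_gt0. Qed.

Lemma flat_ge0 n s : 0 <= flat n s.
Proof. by have [/flat_gt0/ltW//|] := ltP 0 s; rewrite /flat ltNge => ->. Qed.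

Lemma flat_le0 n s : s <= 0 -> flat n s = 0.
Proof. by rewrite /flat ltNge => ->. Qed.

(** With [u = 1/s], a single term of the exponential series gives [exp u >= u^(n+2) / (n+2)!]. A
    quadratic bound is what forces the derivative 0 at the origin, where the two formulas of [flat]
    meet. *)
Lemma flat_le_sqr n s : flat n s <= n.+2`!%:R * s ^+ 2.
Proof.
have [s0|s0] := ltP 0 s; last by rewrite flat_le0// mulr_ge0// sqr_ge0.
have u0 : 0 < s^-1 by rewrite invr_gt0.
have := expR_ge1Dxn n.+1 (ltW u0).
move=> /(le_trans _) => /(_ (s^-1 ^+ n.+2 / n.+2`!%:R)).
rewrite lerDr ler01 => /(_ isT) h.
rewrite /flat s0 expRN ler_pdivrMr ?expR_gt0//.
have -> : s^-1 ^+ n = n.+2`!%:R * s ^+ 2 * (s^-1 ^+ n.+2 / n.+2`!%:R).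
  rewrite -addn2 exprD.
  have f0 : n.+2`!%:R != 0 :> R by rewrite pnatr_eq0 -lt0n fact_gt0.
  by rewrite addn2; field; rewrite f0 gt_eqF.
by rewrite ler_wpM2l// mulr_ge0// sqr_ge0.
Qed.

Lemma is_derive_le_sqr (f : R -> R) (C : R) :
  (forall s, `|f s| <= C * s ^+ 2) -> is_derive (0 : R) 1 f 0.
Proof.
move=> fC.
have f0 : f 0 = 0.
  by apply/eqP; rewrite -normr_le0; have := fC 0; rewrite expr0n mulr0.
have C0 : 0 <= C by have := fC 1; rewrite expr1n mulr1; exact: le_trans.
have cf : h^-1 *: ((f \o shift 0) (h *: 1) - f 0) @[h --> 0^'] --> 0.
  apply/cvgrPdist_le => e e0; near=> h.
  have h0 : h != 0 by near: h; exact: nbhs_dnbhs_neq.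
  rewrite sub0r normrN f0 subr0 /= addr0 /GRing.scale /= mulr1 normrM normfV.
  rewrite ler_pdivrMl ?normr_gt0//; apply: le_trans (fC _) _.
  rewrite -real_normK ?num_real// expr2 mulrA mulrC ler_wpM2l//.
  (* The [+ 1] keeps the denominator positive when [C = 0]. *)
  have hC : `|h| < e / (C + 1).
    by near: h; apply: dnbhs0_lt; rewrite divr_gt0// ltr_wpDl.
  have C1 : 0 < C + 1 by rewrite ltr_wpDl.
  move: hC; rewrite ltr_pdivlMr// => /ltW; apply: le_trans.
  by rewrite mulrC ler_wpM2l// lerDl.
apply: DeriveDef; first by apply/cvg_ex; exists 0.
exact/cvg_lim.
Unshelve. all: by end_near. Qed.

(** For [s > 0], differentiating the exponential raises the power of [1/s] by 2 and differentiating
    the power raises it by 1. *)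
Lemma is_derive_flat (n : nat) (s : R) :
  is_derive s (1 : R) (flat n) (flat n.+2 s - n%:R * flat n.+1 s).
Proof.
have [s0|s0|->] := ltgtP s 0.
- rewrite !flat_le0 ?(ltW s0)// mulr0 subrr.
  apply: (@near_eq_is_derive _ _ _ (cst 0)).
  by near=> t; rewrite flat_le0//= ltW//; near: t; exact: lt_nbhsl.
- apply: (@near_eq_is_derive _ _ _ (fun t : R => t^-1 ^+ n * expR (- t^-1))).
    by near=> t; rewrite /flat ifT//; near: t; exact: lt_nbhsr.
  rewrite /flat s0.
  have dinv : is_derive s 1 (fun t : R => t^-1) (- s ^- 2).
    apply: DeriveDef; first by apply: derivableV => //; rewrite gt_eqF.
    by rewrite deriveV ?gt_eqF// derive_id /GRing.scale /= mulr1.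
  have -> : (fun t : R => t^-1 ^+ n * expR (- t^-1)) =
      (fun t : R => t^-1) ^+ n * (expR \o (fun t => - t^-1)).
    by apply/funext => t; rewrite mulrfctE exprfctE.
  have := is_deriveM (is_deriveX n dinv)
    (@is_derive1_comp R expR (fun t => - t^-1) s _ _
      (is_derive_expR _) (is_deriveN dinv)).
  move=> /is_derive_eq; apply.
  rewrite exprfctE /GRing.scale /= -exprVn opprK.
  move: (s^-1) => u; move: (expR _) => E; case: n => [|n].
    by rewrite !mul0r; ring.
  by rewrite !exprS; move: (n.+1%:R : R) (u ^+ n) => a b; ring.
- rewrite !flat_le0// mulr0 subrr.
  apply: (@is_derive_le_sqr _ n.+2`!%:R) => t.
  by rewrite ger0_norm ?flat_ge0// flat_le_sqr.
Unshelve. all: by end_near. Qed.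

Lemma is_derive_powR (a s : R) : 0 < s ->
  is_derive s (1 : R) (fun x : R => x `^ a) (a * s `^ (a - 1)).
Proof.
move=> s0; have sI : s \in `]0, +oo[ by rewrite in_itv/= andbT.
by apply: DeriveDef; [exact: derivable_powR|rewrite -derive1E powR_derive1].
Qed.

End flat_functions.

(* Every function of this class has all its directional derivatives, on [U],
   in the class again: smoothness follows from a single induction. *)
Inductive flat_expr (R : realType) (n : nat) (U : set 'rV[R]_n) :
    ('rV[R]_n -> R) -> Prop :=
| flat_expr_cst c : flat_expr U (cst c)
| flat_expr_coord i : flat_expr U (fun x => x ord0 i)
| flat_expr_add f g : flat_expr U f -> flat_expr U g -> flat_expr U (f + g)
| flat_expr_mul f g : flat_expr U f -> flat_expr U g -> flat_expr U (f * g)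
| flat_expr_flat k f : flat_expr U f -> flat_expr U (flat k \o f)
| flat_expr_powR a f : flat_expr U f -> (forall x, U x -> 0 < f x) ->
    flat_expr U (fun x => f x `^ a).

Section flat_expr_theory.
Context {R : realType} {n : nat}.
Implicit Types (U : set 'rV[R]_n) (f : 'rV[R]_n -> R).

Lemma flat_expr_differentiable U f x :
  flat_expr U f -> U x -> differentiable f x.
Proof.
move=> ef Ux; elim: ef => {f}
  [c|i|f g _ df _ dg|f g _ df _ dg|k f _ df|a f _ df f0].
- exact: differentiable_cst.
- exact: differentiable_coord.
- exact: differentiableD.
- exact: differentiableM.
- exact: differentiable_comp_real df (is_derive_flat k (f x)).
- exact: differentiable_comp_real df (is_derive_powR a (f0 _ Ux)).
Qed.

Lemma flat_expr_derive U f v : flat_expr U f ->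
  exists2 g, flat_expr U g & forall x, U x -> 'D_v f x = g x.
Proof.
elim=> {f} [c|i|f g ef [f' ef' Df] eg [g' eg' Dg]
    |f g ef [f' ef' Df] eg [g' eg' Dg]
    |k f ef [f' ef' Df]|a f ef [f' ef' Df] f0].
- by exists (cst 0) => [|x _]; [exact: flat_expr_cst|rewrite derive_cst].
- exists (cst (v ord0 i)) => [|x _]; first exact: flat_expr_cst.
  have : derivable (@id 'rV[R]_n) x v by exact: derivable_id.
  move=> /derive_mx; rewrite derive_id => /rowP /(_ i).
  by rewrite mxE => <-.
- exists (f' + g'); first exact: flat_expr_add.
  move=> x Ux; rewrite deriveD ?Df ?Dg//.
    exact/diff_derivable/(flat_expr_differentiable ef).
  exact/diff_derivable/(flat_expr_differentiable eg).
- exists (f * g' + g * f'); first by apply: flat_expr_add; exact: flat_expr_mul.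
  move=> x Ux; rewrite deriveM ?Df ?Dg//.
    exact/diff_derivable/(flat_expr_differentiable ef).
  exact/diff_derivable/(flat_expr_differentiable eg).
- exists ((flat k.+2 \o f + cst (- k%:R) * (flat k.+1 \o f)) * f').
    apply: flat_expr_mul => //; apply: flat_expr_add; first exact: flat_expr_flat.
    by apply: flat_expr_mul; [exact: flat_expr_cst|exact: flat_expr_flat].
  move=> x Ux.
  have df := flat_expr_differentiable ef Ux.
  rewrite (derive_comp_real v df (is_derive_flat k (f x))) Df//.
  by rewrite !fctE /= mulNr.
- exists (cst a * (fun x => f x `^ (a - 1)) * f').
    apply: flat_expr_mul => //; apply: flat_expr_mul; first exact: flat_expr_cst.
    exact: flat_expr_powR.
  move=> x Ux.
  have df := flat_expr_differentiable ef Ux.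
  by rewrite (derive_comp_real v df (is_derive_powR a (f0 x Ux))) Df.
Qed.

Lemma flat_expr_sum U (I : Type) (r : seq I) (F : I -> 'rV[R]_n -> R) :
  (forall i, flat_expr U (F i)) -> flat_expr U (fun x => \sum_(i <- r) F i x).
Proof.
move=> eF; elim: r => [|i r IHr].
  have -> : (fun x => \sum_(i <- [::]) F i x) = cst 0.
    by apply/funext => x; rewrite big_nil.
  exact: flat_expr_cst.
have -> : (fun x => \sum_(j <- i :: r) F j x) =
    F i + (fun x => \sum_(j <- r) F j x).
  by apply/funext => x; rewrite big_cons.
exact: flat_expr_add.
Qed.

Lemma row_flat_expr_differentiable U p (g : 'I_p -> 'rV[R]_n -> R) x :
  (forall j, flat_expr U (g j)) -> U x ->
  differentiable (fun y => \row_j g j y) x.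
Proof.
move=> eg Ux.
have -> : (fun y => \row_j g j y) =
    \sum_(j < p) (fun y => g j y *: (delta_mx ord0 j : 'rV[R]_p)).
  apply/funext => y; rewrite fct_sumE [LHS]row_sum_delta.
  by apply: eq_bigr => j _; rewrite mxE.
apply: differentiable_sum => j.
exact/differentiableZl/(flat_expr_differentiable (eg j)).
Qed.

(** [F] is only compared with the row on [U], because ['D_v F] is identified with expressions of the
    class only there. Openness of [U] turns this into agreement near each point, which is what
    derivatives see. *)
Lemma class_C_row_flat_expr U p (F : 'rV[R]_n -> 'rV[R]_p)
    (g : 'I_p -> 'rV[R]_n -> R) (k : nat) :
  open U -> (forall j, flat_expr U (g j)) ->
  (forall x, U x -> F x = \row_j g j x) -> class_C k U F.
Proof.
move=> Uo; elim: k F g => [|k IHk] F g eg FE /=.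
  move=> x Ux; apply: differentiable_continuous.
  apply: (near_eq_differentiable _ (row_flat_expr_differentiable eg Ux)).
  near=> y; rewrite FE//; near: y; exact: open_nbhs_nbhs.
have FEx x : U x -> \forall y \near x, \row_j g j y = F y.
  move=> Ux; near=> y; rewrite FE//; near: y; exact: open_nbhs_nbhs.
split=> [x Ux|v].
  exact: near_eq_differentiable (FEx x Ux) (row_flat_expr_differentiable eg Ux).
have /choice[g' g'P] : forall j, exists g', flat_expr U g' /\
    forall x, U x -> 'D_v (g j) x = g' x.
  by move=> j; have [h] := flat_expr_derive v (eg j); exists h.
apply: (IHk _ g') => [j|x Ux]; first by case: (g'P j).
rewrite -(near_eq_derive v (FEx x Ux)) derive_mx; last first.
  exact/diff_derivable/(row_flat_expr_differentiable eg).
apply/rowP => j; rewrite !mxE -(g'P j).2//; congr ('D_v _ x).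
by apply/funext => y; rewrite mxE.
Unshelve. all: by end_near. Qed.

Lemma smooth_row_flat_expr U p (g : 'I_p -> 'rV[R]_n -> R) :
  open U -> (forall j, flat_expr U (g j)) -> smooth_on U (fun x => \row_j g j x).
Proof. by move=> Uo eg k; exact: class_C_row_flat_expr Uo eg _. Qed.

End flat_expr_theory.

(** * Euclidean geometry *)

Section euclidean.
Context {R : realType} {n : nat}.
Implicit Types (x y z P : 'rV[R]_n) (a : R).

Definition dot x y : R := (x *m y^T) ord0 ord0.

Lemma dotC x y : dot x y = dot y x.
Proof. by rewrite /dot -[x *m _]trmxK [LHS]mxE trmx_mul trmxK. Qed.

Lemma dotDl x y z : dot (x + y) z = dot x z + dot y z.
Proof. by rewrite /dot mulmxDl mxE. Qed.

Lemma dotZl a x y : dot (a *: x) y = a * dot x y.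
Proof. by rewrite /dot -scalemxAl mxE. Qed.

Lemma dotDr x y z : dot z (x + y) = dot z x + dot z y.
Proof. by rewrite dotC dotDl !(dotC z). Qed.

Lemma dotZr a x y : dot y (a *: x) = a * dot y x.
Proof. by rewrite dotC dotZl (dotC y). Qed.

Lemma dotxxE x : dot x x = \sum_i x ord0 i ^+ 2.
Proof. by rewrite /dot mxE; apply: eq_bigr => i _; rewrite mxE expr2. Qed.

Lemma dotxx_ge0 x : 0 <= dot x x.
Proof. by rewrite dotxxE sumr_ge0// => i _; exact: sqr_ge0. Qed.

Lemma dotxx_eq0 x : (dot x x == 0) = (x == 0).
Proof.
apply/eqP/eqP => [|->]; last by rewrite /dot mul0mx mxE.
rewrite dotxxE => /eqP; rewrite psumr_eq0; last by move=> i _; exact: sqr_ge0.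
move=> /allP x0; apply/rowP => i; rewrite mxE.
by have := x0 i; rewrite mem_index_enum sqrf_eq0 => /(_ isT)/eqP.
Qed.

Lemma enormE x : enorm x = Num.sqrt (dot x x).
Proof. by rewrite dotxxE. Qed.

Lemma sqr_enorm x : enorm x ^+ 2 = dot x x.
Proof. by rewrite enormE sqr_sqrtr// dotxx_ge0. Qed.

Lemma enorm_ge0 x : 0 <= enorm x.
Proof. by rewrite enormE sqrtr_ge0. Qed.

Lemma enormZ a x : enorm (a *: x) = `|a| * enorm x.
Proof.
rewrite !enormE dotZl dotZr mulrA sqrtrM ?sqr_ge0// -?expr2 ?sqr_ge0//.
by rewrite sqrtr_sqr.
Qed.

Lemma enormN x : enorm (- x) = enorm x.
Proof. by rewrite -scaleN1r enormZ normrN1 mul1r. Qed.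

Lemma enormB x y : enorm (x - y) = enorm (y - x).
Proof. by rewrite -enormN opprB. Qed.

Lemma dot_le_enorm x y : dot x y <= enorm x * enorm y.
Proof.
have [->|y0] := eqVneq y 0.
  by rewrite /dot trmx0 mulmx0 mxE mulr_ge0 ?enorm_ge0.
have yy0 : 0 < dot y y by rewrite lt_neqAle dotxx_ge0 eq_sym dotxx_eq0 y0.
have [xy0|xy0] := leP 0 (dot x y); last first.
  by apply: le_trans (ltW xy0) _; rewrite mulr_ge0 ?enorm_ge0.
rewrite -(@ler_pXn2r _ 2)// ?nnegrE ?mulr_ge0 ?enorm_ge0//.
rewrite exprMn !sqr_enorm.
(* This vector is [dot y y] times the component of [x] orthogonal to [y]; its square is [dot y y]
   times the difference of the two sides. *)
have := dotxx_ge0 (dot y y *: x + (- dot x y) *: y).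
rewrite !(dotDl, dotDr, dotZl, dotZr) (dotC y x).
rewrite (_ : _ + _ = dot y y * (dot x x * dot y y - dot x y ^+ 2)); last by ring.
by rewrite pmulr_rge0// subr_ge0.
Qed.

Lemma enormD x y : enorm (x + y) <= enorm x + enorm y.
Proof.
rewrite -(@ler_pXn2r _ 2)// ?nnegrE ?addr_ge0 ?enorm_ge0//.
rewrite sqrrD !sqr_enorm !(dotDl, dotDr) (dotC y x).
have := dot_le_enorm x y; lra.
Qed.

Lemma enorm_triangle y x z : enorm (x - z) <= enorm (x - y) + enorm (y - z).
Proof. by rewrite -[x - z](subrKA y) enormD. Qed.

(** The ambient topology comes from the sup norm, so the argument goes through [dot z z], a
    polynomial in the coordinates. *)
Lemma continuous_enorm : continuous (@enorm R n).
Proof.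
have dif (x : 'rV[R]_n) : differentiable (fun z : 'rV[R]_n => dot z z) x.
  have -> : (fun z : 'rV[R]_n => dot z z) =
      \sum_(i < n) ((fun z : 'rV[R]_n => z ord0 i) * (fun z => z ord0 i)).
    apply/funext => z; rewrite fct_sumE dotxxE.
    by apply: eq_bigr => i _; rewrite expr2.
  apply: differentiable_sum => i.
  by apply: differentiableM; exact: differentiable_coord.
move=> x; rewrite (_ : @enorm R n = Num.sqrt \o (fun z => dot z z)); last first.
  by apply/funext => z; rewrite enormE.
apply: continuous_comp; first exact/differentiable_continuous/dif.
exact: sqrt_continuous.
Qed.

Lemma open_eball P a : open (eball P a).
Proof.
rewrite (_ : eball P a = (fun x => enorm (x - P)) @^-1` [set t | t < a])//.
apply: open_comp; last exact: open_lt.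
move=> x _; apply: continuous_comp; last exact: continuous_enorm.
by apply: continuousB => //; exact: cst_continuous.
Qed.

Lemma eballxx P a : 0 < a -> eball P a P.
Proof. by move=> a0; rewrite /eball /= subrr enormE /dot mul0mx mxE sqrtr0. Qed.

Lemma eball_le_segment P a x y (s : R) : 0 <= s <= 1 ->
  enorm (x - P) <= a -> enorm (x + y - P) <= a -> enorm (x + s *: y - P) <= a.
Proof.
move=> /andP[s0 s1] xa ya.
have -> : x + s *: y - P = (1 - s) *: (x - P) + s *: (x + y - P).
  by apply/rowP => i; rewrite !mxE; ring.
apply: le_trans (enormD _ _) _; rewrite !enormZ !ger0_norm ?subr_ge0//.
have : (1 - s) * enorm (x - P) <= (1 - s) * a by rewrite ler_wpM2l ?subr_ge0.
have : s * enorm (x + y - P) <= s * a by rewrite ler_wpM2l.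
lra.
Qed.

End euclidean.

Lemma col'_mulmx (R : realType) n p q (j : 'I_q) (A : 'M[R]_(n, p))
  (B : 'M[R]_(p, q)) : col' j (A *m B) = A *m col' j B.
Proof.
by apply/matrixP => i k; rewrite !mxE; apply: eq_bigr => l _; rewrite !mxE.
Qed.

Lemma continuous_mulmxr (R : realType) n p (A : 'M[R]_(n, p)) :
  continuous (mulmx ^~ A : 'rV[R]_n -> 'rV[R]_p).
Proof.
move=> x; apply: differentiable_continuous.
have -> : mulmx ^~ A = \sum_(i < n) (fun z : 'rV[R]_n => z ord0 i *: row i A).
  by apply/funext => z; rewrite fct_sumE mulmx_sum_row.
apply: differentiable_sum => i.
exact/differentiableZl/differentiable_coord.
Qed.

Section frames.
Context {R : realType} {n : nat}.
Implicit Types (Q : 'M[R]_n.+1) (x y : 'rV[R]_n.+1) (u : 'rV[R]_n).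

Lemma enorm_frame Q y : orthonormal_frame Q -> enorm (y *m Q) = enorm y.
Proof.
by move=> QQ; rewrite !enormE /dot trmx_mul mulmxA -(mulmxA y) QQ mulmx1.
Qed.

Lemma frameK Q x : orthonormal_frame Q -> x *m Q *m Q^T = x.
Proof. by move=> QQ; rewrite -mulmxA QQ mulmx1. Qed.

Lemma frame_coordK Q x : orthonormal_frame Q -> x *m Q^T *m Q = x.
Proof. by move=> /mulmx1C QQ; rewrite -mulmxA QQ mulmx1. Qed.

(** A good direction requires a whole frame, while averaging yields only its last vector. *)
Lemma frame_completion (n0 : 'rV[R]_n.+1) : unit_sphere n0 ->
  exists2 Q, orthonormal_frame Q & row ord_max Q = n0.
Proof.
move=> n1.
pose e : 'rV[R]_n.+1 := delta_mx ord0 ord_max.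
have nn : dot n0 n0 = 1 by rewrite -sqr_enorm n1 expr1n.
have ee : dot e e = 1.
  rewrite dotxxE (bigD1 ord_max)//= mxE !eqxx expr1n big1 ?addr0// => i im.
  by rewrite mxE (negbTE im) andbF expr0n.
(* When [e = n0] the vector [w] below vanishes and defines no reflection. *)
have [en|en] := eqVneq e n0.
  exists 1%:M; first by rewrite /orthonormal_frame trmx1 mulmx1.
  by rewrite rowE mulmx1.
pose w := e - n0.
have ww0 : dot w w != 0 by rewrite dotxx_eq0 subr_eq0.
(* This uses that [e] and [n0] have equal length; it gives [c * dot e w = 1], so the reflection
   sends [e] to [e - w = n0]. *)
have wwE : dot w w = 2 * dot e w.
  rewrite /w -[- n0]scaleN1r !(dotDl, dotDr, dotZl, dotZr) ee nn (dotC n0).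
  by ring.
(* Q is the Householder reflection exchanging [n0] and the last basis vector. *)
pose c := 2 / dot w w.
pose Q : 'M[R]_n.+1 := 1%:M - c *: (w^T *m w).
have wwT : w *m w^T = (dot w w)%:M.
  by rewrite [LHS]mx11_scalar.
have QT : Q^T = Q.
  by rewrite /Q linearB /= trmx1 linearZ /= trmx_mul trmxK.
exists Q.
  rewrite /orthonormal_frame QT /Q mulmxBl mul1mx (mulmxBr _ 1%:M) mulmx1.
  rewrite -scalemxAl -scalemxAr -mulmxA (mulmxA w) wwT mul_scalar_mx.
  rewrite -scalemxAr !scalerA (_ : c * (c * dot w w) = c + c); last first.
    by rewrite /c; field.
  by rewrite scalerDl opprB addrK subrK.
rewrite rowE -/e /Q (mulmxBr _ 1%:M) mulmx1 -scalemxAr mulmxA.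
rewrite [e *m w^T]mx11_scalar -/(dot e w) mul_scalar_mx scalerA.
rewrite (_ : c * dot e w = 1) ?scale1r; first by rewrite /w opprB addrC subrK.
by rewrite /c wwE; field; move: ww0; rewrite wwE mulf_eq0 negb_or => /andP[].
Qed.

(** Inverse of splitting a row into [col' ord_max y] and its last coordinate: a base [u] and a
    height [s]. *)
Definition glue u (s : R) : 'rV[R]_n.+1 :=
  \row_j (if unlift ord_max j is Some k then u ord0 k else s).

Lemma col'_glue u s : col' ord_max (glue u s) = u.
Proof. by apply/rowP => j; rewrite !mxE liftK. Qed.

Lemma glue_last u s : glue u s ord0 ord_max = s.
Proof. by rewrite mxE unlift_none. Qed.

Lemma glueK y : glue (col' ord_max y) (y ord0 ord_max) = y.
Proof. by apply/rowP => j; rewrite mxE; case: unliftP => [k|] ->; rewrite ?mxE. Qed.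

Lemma mulmx_glue u s Q :
  glue u s *m Q = u *m row' ord_max Q + s *: row ord_max Q.
Proof.
apply/rowP => j; rewrite !mxE (bigD1_ord ord_max)//= addrC; congr (_ + _).
  by apply: eq_bigr => i _; rewrite !mxE liftK.
by rewrite !mxE unlift_none.
Qed.

Lemma dot_glue u s : dot (glue u s) (glue u s) = dot u u + s ^+ 2.
Proof.
rewrite !dotxxE (bigD1_ord ord_max)//= addrC; congr (_ + _).
  by apply: eq_bigr => i _; rewrite !mxE liftK.
by rewrite !mxE unlift_none.
Qed.

Lemma enorm_glue_lt u s (delta : R) : 0 < delta ->
  (enorm (glue u s) < delta) = (`|s| < Num.sqrt (delta ^+ 2 - dot u u)).
Proof.
move=> d0.
rewrite -[LHS](@ltr_pXn2r _ 2) ?nnegrE ?enorm_ge0 ?(ltW d0)//.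
rewrite sqr_enorm dot_glue -sqrtr_sqr addrC -ltrBrDr.
have [h|h] := ltP 0 (delta ^+ 2 - dot u u); first by rewrite ltr_sqrt.
(* [Num.sqrt] is 0 on nonpositive numbers, so both inequalities fail when the line over [u] misses
   the ball. *)
rewrite (ler0_sqrtr h) !ltNge sqrtr_ge0/=.
by rewrite (le_trans h)// sqr_ge0.
Qed.

Lemma frame_glueE P Q x : orthonormal_frame Q -> exists u s, x = P + glue u s *m Q.
Proof.
move=> QQ; pose y := (x - P) *m Q^T.
exists (col' ord_max y), (y ord0 ord_max).
by rewrite glueK /y frame_coordK// addrC subrK.
Qed.

Lemma eball_glue P delta Q u s : orthonormal_frame Q -> 0 < delta ->
  eball P delta (P + glue u s *m Q) <->
  `|s| < Num.sqrt (delta ^+ 2 - dot u u).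
Proof.
by move=> QQ d0; rewrite /eball /= addrC addKr enorm_frame// enorm_glue_lt.
Qed.

Lemma continuous_glue Q P s :
  continuous (fun u => P + glue u s *m Q).
Proof.
have -> : (fun u => P + glue u s *m Q) =
    cst P + (mulmx ^~ (row' ord_max Q) + cst (s *: row ord_max Q)).
  by apply/funext => u; rewrite mulmx_glue.
move=> u.
apply: continuousD; first exact: cst_continuous.
by apply: continuousD; [exact: continuous_mulmxr|exact: cst_continuous].
Qed.

End frames.

(** * Convexity of the cone of upward directions *)

(* [closure Omega] rather than [Omega]: the strictness expresses that the
   boundary contains no segment in the direction [v], hence is a graph. *)
Definition upward (R : realType) (n : nat) (Omega B : set 'rV[R]_n)
    (v : 'rV[R]_n) : Prop :=
  forall x (t : R), closure Omega x -> B x -> 0 < t -> B (x + t *: v) ->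
    Omega (x + t *: v).

Section upward_theory.
Context {R : realType} {n : nat}.
Implicit Types (Omega B : set 'rV[R]_n) (v w P : 'rV[R]_n).

Lemma upward_sub Omega B B' v : B' `<=` B -> upward Omega B v -> upward Omega B' v.
Proof. by move=> BB up x t clx /BB Bx t0 /BB; exact: up. Qed.

Lemma upwardZ Omega B (a : R) v : 0 < a -> upward Omega B v ->
  upward Omega B (a *: v).
Proof.
move=> a0 up x t clx Bx t0; rewrite scalerA.
by apply: up => //; rewrite mulr_gt0.
Qed.

(** The zero vector would move a boundary point nowhere and yet into [Omega], which is its own
    interior. *)
Lemma upward_neq0 Omega B v : open Omega -> B `&` boundary Omega !=set0 ->
  upward Omega B v -> v != 0.
Proof.
move=> oO [x [Bx [clx nix]]] up; apply/eqP => v0; apply: nix.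
move/interior_id: oO => ->.
by have := up x 1 clx Bx ltr01; rewrite v0 scaler0 addr0; exact.
Qed.

(* Follow the segment by a staircase of steps along [v] and [w], fine enough to
   stay in the ball. *)
Lemma upwardD Omega P (delta : R) v w :
  upward Omega (eball P delta) v -> upward Omega (eball P delta) w ->
  upward Omega (eball P delta) (v + w).
Proof.
move=> uv uw x t clx Bx t0 Bxt.
(* By convexity [M] bounds the distance to [P] along the whole segment. The margin [delta - M] is
   what a single step along [v] may use up, which dictates the number [N.+1] of steps. *)
pose M := Num.max (enorm (x - P)) (enorm (x + t *: (v + w) - P)).
have Md : M < delta by rewrite gt_max Bx.
have [N NP] : exists N : nat, t * enorm v / (delta - M) < N.+1%:R.
  exists (Num.bound (t * enorm v / (delta - M))).
  apply: lt_trans (archi_boundP _) _; last by rewrite ltr_nat.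
  by rewrite divr_ge0 ?subr_ge0 ?mulr_ge0 ?enorm_ge0 ?ltW.
pose h := t / N.+1%:R.
have h0 : 0 < h by rewrite divr_gt0.
have hv : h * enorm v < delta - M.
  move: NP; rewrite ltr_pdivrMr ?subr_gt0// => NP.
  by rewrite /h mulrAC ltr_pdivrMr// [ltRHS]mulrC.
pose X k := x + (k%:R * h) *: (v + w).
have BX k : (k <= N.+1)%N -> enorm (X k - P) <= M.
  move=> kN; rewrite /X (_ : k%:R * h = k%:R / N.+1%:R * t); last by rewrite /h; ring.
  rewrite -scalerA; apply: eball_le_segment.
  - by rewrite divr_ge0//= ler_pdivrMr// mul1r ler_nat.
  - by rewrite le_max lexx.
  - by rewrite le_max lexx orbT.
have XS k : X k + h *: v + h *: w = X k.+1.
  rewrite /X -addrA -scalerDr -addrA -scalerDl -natr1.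
  by congr (_ + _ *: _); ring.
(* The corner [X k + h *: v] stays in the ball thanks to the margin, and the step along [w] returns
   to the segment. Starting from [closure Omega] covers the first step, which leaves from [x]. *)
have stepX k : (k <= N)%N -> closure Omega (X k) -> Omega (X k.+1).
  move=> kN clX.
  rewrite -XS.
  have BXv : eball P delta (X k + h *: v).
    rewrite /eball /= addrAC; apply: le_lt_trans (enormD _ _) _.
    rewrite enormZ gtr0_norm//; have := BX k (leqW kN); lra.
  have := uv (X k) h clX _ h0 BXv.
  move=> /(_ (le_lt_trans (BX k (leqW kN)) Md)) OXv.
  apply: uw => //; first exact: subset_closure.
  by rewrite XS; exact: le_lt_trans (BX _ _) Md.
have clX k : (k <= N)%N -> closure Omega (X k).
  elim: k => [_|k IHk kN]; first by rewrite /X mul0r scale0r addr0.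
  exact: subset_closure (stepX k (ltnW kN) (IHk (ltnW kN))).
have := stepX N (leqnn _) (clX N (leqnn _)).
by rewrite /X /h mulrC divfK.
Qed.

Lemma upward_sum Omega P (delta : R) (I : eqType) (r : seq I) (c : I -> R)
    (v : I -> 'rV[R]_n) :
  (forall i, i \in r -> 0 <= c i) ->
  (forall i, i \in r -> 0 < c i -> upward Omega (eball P delta) (v i)) ->
  (exists2 i, i \in r & 0 < c i) ->
  upward Omega (eball P delta) (\sum_(i <- r) c i *: v i).
Proof.
move=> c0 up [i0 i0r ci0].
(* Weights may vanish and a zero term need not be upward, so partial sums are tracked as zero or
   upward; the positive term [i0], set aside, then makes the total upward. *)
pose Z u := u = 0 \/ upward Omega (eball P delta) u.
have ZD u1 u2 : Z u1 -> Z u2 -> Z (u1 + u2).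
  case=> [->|up1]; first by rewrite add0r.
  case=> [->|up2]; first by rewrite addr0; right.
  by right; exact: upwardD.
have Zi i : i \in r -> Z (c i *: v i).
  move=> ir; have := c0 i ir; rewrite le_eqVlt => /orP[/eqP <-|ci].
    by left; rewrite scale0r.
  by right; apply: upwardZ => //; exact: up.
have up0 := upwardZ ci0 (up _ i0r ci0).
rewrite (perm_big _ (perm_to_rem i0r)) big_cons.
have : Z (\sum_(i <- rem i0 r) c i *: v i).
  rewrite big_seq; apply: (big_ind Z) => //; first by left.
  by move=> i /mem_rem; exact: Zi.
by case=> [->|] /=; [rewrite addr0|exact: upwardD].
Qed.

End upward_theory.

(** * Upward directions and epigraphs *)

Section epigraph.
Context {R : realType} {m : nat}.
Variables (Omega : set 'rV[R]_m.+1) (P : 'rV[R]_m.+1) (delta : R)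
  (Q : 'M[R]_m.+1).
Hypotheses (oO : open Omega) (d0 : 0 < delta) (QQ : orthonormal_frame Q).

Let pt (u : 'rV[R]_m) s : 'rV[R]_m.+1 := P + glue u s *m Q.
(** Half the length of the chord of the ball over [u], and 0 when there is no chord. *)
Let rad (u : 'rV[R]_m) : R := Num.sqrt (delta ^+ 2 - dot u u).

Lemma local_epigraph_glueP (f : 'rV[R]_m -> R) :
  local_epigraph Omega P delta Q f <->
  (forall u s, `|s| < rad u -> (Omega (pt u s) <-> f u < s)).
Proof.
split=> [loc u s sr|H].
  have Bus : eball P delta (pt u s) by exact/eball_glue.
  split=> [Ous|fus].
    have : (Omega `&` eball P delta) (pt u s) by [].
    rewrite loc => -[y /= [fy _]] /addrI yE.
    move: fy; have <- : glue u s = y by rewrite -[LHS](frameK _ QQ) -yE frameK.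
    by rewrite col'_glue glue_last.
  have : [set P + y *m Q | y in [set y : 'rV[R]_m.+1 |
      f (col' ord_max y) < y ord0 ord_max /\ enorm y < delta]] (pt u s).
    exists (glue u s) => //=.
    by rewrite col'_glue glue_last enorm_glue_lt.
  by rewrite -loc => -[].
apply/seteqP; split=> [x []|_ [y /= [fy yd] <-]].
  have [u [s ->]] := frame_glueE P x QQ.
  move=> Ox Bx; have /H H' := (eball_glue P u s QQ d0).1 Bx.
  exists (glue u s) => //=; rewrite col'_glue glue_last.
  by split; [exact/H'|rewrite -(enorm_frame _ QQ) -[_ *m _](addKr P) addrC].
rewrite -[y]glueK; have yr : `|y ord0 ord_max| < rad (col' ord_max y).
  by rewrite -enorm_glue_lt// glueK.
by split; [exact/H|exact/eball_glue].
Qed.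

Lemma pt_shift u s t : pt u s + t *: row ord_max Q = pt u (s + t).
Proof. by rewrite /pt !mulmx_glue scalerDl !addrA. Qed.

Lemma continuous_pt s : continuous (pt ^~ s).
Proof. exact: continuous_glue. Qed.

(** By continuity of [f], a point strictly below the graph has a neighbourhood free of [Omega].
    Points of the closure thus lie on or above the graph, and any move up puts them strictly
    above. *)
Lemma local_epigraph_upward (f : 'rV[R]_m -> R) : continuous f ->
  local_epigraph Omega P delta Q f ->
  upward Omega (eball P delta) (row ord_max Q).
Proof.
move=> cf /local_epigraph_glueP epi x t.
have [u [s ->]] := frame_glueE P x QQ; rewrite -/(pt u s) pt_shift.
move=> clx Bx t0 Bxt.
have /epi[_] := (eball_glue P u (s + t) QQ d0).1 Bxt; apply.
apply: (@le_lt_trans _ _ s); last by rewrite ltrDl.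
rewrite leNgt; apply/negP => sf.
pose y z := (z - P) *m Q^T.
pose g z := f (col' ord_max (y z)) - y z ord0 ord_max.
have cy : continuous y.
  move=> z; have -> : y = mulmx ^~ Q^T \o (fun z => z - P) by [].
  apply: continuous_comp.
    by apply: continuousB => //; exact: cst_continuous.
  exact: continuous_mulmxr.
have cg : continuous g.
  move=> z; apply: continuousB.
    have -> : (fun z => f (col' ord_max (y z))) =
        f \o (mulmx ^~ (col' ord_max 1%:M)) \o y.
      apply/funext => v /=; congr f.
      by rewrite -[X in col' _ X](mulmx1 (y v)) col'_mulmx.
    apply: continuous_comp; first exact: cy.
    apply: continuous_comp; [exact: continuous_mulmxr|exact: cf].
  exact: continuous_comp (cy z) (@coord_continuous _ _ _ _ _ _).
have yK z : P + y z *m Q = z by rewrite /y frame_coordK// addrC subrK.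
have yglue : y (pt u s) = glue u s by rewrite /y /pt (addrC P) addrK frameK.
have W : nbhs (pt u s) (eball P delta `&` [set z | 0 < g z]).
  apply: filterI; first by apply: open_nbhs_nbhs; split=> //; exact: open_eball.
  apply: open_nbhs_nbhs; split.
    have : open (g @^-1` [set a | 0 < a]); last exact.
    by apply: open_comp; [move=> ? _; exact: cg|exact: open_gt].
  by rewrite /= /g yglue col'_glue glue_last subr_gt0.
have [z [Oz [Bz gz]]] := clx _ W.
move: Oz Bz; rewrite -(yK z) -[y z]glueK => Oz /eball_glue => /(_ QQ d0) /epi[+ _].
move=> /(_ Oz); apply/negP; rewrite -leNgt ltW//.
by rewrite -subr_gt0.
Qed.

(* Adding the upper end [rad u] keeps the set nonempty, and makes the infimum
   extend continuously by 0 outside the disk, where [rad] vanishes. *)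
Let A u := [set s | s = rad u \/ (`|s| < rad u /\ Omega (pt u s))].

Definition lower_graph (u : 'rV[R]_m) : R := inf (A u).

Section lower_graph.
Hypothesis up : upward Omega (eball P delta) (row ord_max Q).

Let A_lbound u : lbound (A u) (- rad u).
Proof.
have r0 : 0 <= rad u by exact: sqrtr_ge0.
by move=> s [->|[/ltr_normlP[sr _] _]]; [lra|rewrite lerNl ltW].
Qed.

Let A_has_inf u : has_inf (A u).
Proof.
by split; [exists (rad u); left|exists (- rad u); exact: A_lbound].
Qed.

Lemma lower_graph_ge u : - rad u <= lower_graph u.
Proof. by apply: lb_le_inf; [exists (rad u); left|exact: A_lbound]. Qed.

Lemma lower_graph_le u : lower_graph u <= rad u.
Proof. by apply: ge_inf; [case: (A_has_inf u)|left]. Qed.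

Lemma lower_graph_lt_open u s : `|s| < rad u -> lower_graph u < s -> Omega (pt u s).
Proof.
move=> sr fs.
(* The added value [rad u] exceeds [s], so the element found below [s] is the height of a point of
   [Omega], from which [up] climbs to [s]. *)
have [v [->|[vr Ov]] vs] := inf_lt (A_has_inf u).1 fs.
  by move: sr; rewrite ltr_norml (ltNge s) (ltW vs) andbF.
have -> : s = v + (s - v) by rewrite addrC subrK.
rewrite -pt_shift; apply: up; rewrite ?subr_gt0 ?pt_shift ?(addrC v) ?subrK//.
- exact: subset_closure.
- exact/eball_glue.
- exact/eball_glue.
Qed.

(** Openness of [Omega] leaves room to go down a little, so the infimum is not attained inside the
    chord. *)
Lemma open_lower_graph_lt u s : `|s| < rad u -> Omega (pt u s) -> lower_graph u < s.
Proof.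
move=> sr Os.
have [e e0 [er Oe]] : exists2 e, 0 < e & `|s - e| < rad u /\ Omega (pt u (s - e)).
  have cpt : continuous (pt u).
    have -> : pt u = cst (pt u 0) + *:%R ^~ (row ord_max Q).
      by apply/funext => v; rewrite -[v in LHS]add0r -pt_shift.
    move=> v; apply: continuousD; first exact: cst_continuous.
    exact: scalel_continuous.
  have : nbhs s ([set v | `|v| < rad u] `&` pt u @^-1` Omega).
    apply: filterI; last by apply: cpt; exact: open_nbhs_nbhs.
    by apply: (cvgr_lt `|s| (@norm_continuous _ _ s)).
  move=> /nbhs_ballP[e /= e0 eP]; exists (e / 2); first by rewrite divr_gt0.
  apply: eP; rewrite /ball /= opprB addrC subrK gtr0_norm ?divr_gt0//.
  by rewrite ltr_pdivrMr// ltr_pMr// ltr1n.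
apply: (@le_lt_trans _ _ (s - e)); last by rewrite ltrBlDr ltrDl.
by apply: ge_inf; [case: (A_has_inf u)|right].
Qed.

(** This rests on the closure in [upward]: moving up from such a point would put the midpoint
    between it and the graph into [Omega], below the infimum. *)
Lemma lower_graph_lt_closure u s : `|s| < rad u -> s < lower_graph u ->
  ~ closure Omega (pt u s).
Proof.
move=> sr sf clO.
pose t := (lower_graph u - s) / 2.
have t0 : 0 < t by rewrite divr_gt0// subr_gt0.
have str : `|s + t| < rad u.
  have := lower_graph_le u; have := lower_graph_ge u.
  move: sr; rewrite !ltr_norml /t; lra.
have Bs v : `|v| < rad u -> eball P delta (pt u v) by move=> ?; exact/eball_glue.
have := up clO (Bs _ sr) t0; rewrite pt_shift => /(_ (Bs _ str)).
move=> /(open_lower_graph_lt str); rewrite /t; lra.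
Qed.

(** Upper semicontinuity comes from openness of [Omega], lower semicontinuity from openness of the
    complement of its closure, each tested at distance [e / 2] from the graph. Where distance [e]
    passes the end of the chord, the bounds by [rad] and its continuity suffice. *)
Lemma continuous_lower_graph : continuous lower_graph.
Proof.
have crad : continuous rad.
  have -> : rad = Num.sqrt \o (cst (delta ^+ 2) - @enorm R m * @enorm R m).
    by apply/funext => v; rewrite /rad -sqr_enorm expr2.
  move=> v; apply: continuous_comp; last exact: sqrt_continuous.
  apply: continuousB; first exact: cst_continuous.
  by apply: continuousM; exact: continuous_enorm.
move=> u; apply/(@cvgrPdist_lt _ _ _ (nbhs u) (nbhs_filter u)) => e e0.
have fge := lower_graph_ge u; have fle := lower_graph_le u.
have ubd : \forall v \near u, lower_graph v < lower_graph u + e.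
  have [rc|cr] := ltP (rad u) (lower_graph u + e).
    near=> v; apply: le_lt_trans (lower_graph_le v) _; near: v.
    exact: (cvgr_lt (rad u) (crad u)).
  pose s := lower_graph u + e / 2.
  have sr : `|s| < rad u by rewrite ltr_norml /s; lra.
  have Os : Omega (pt u s) by apply: lower_graph_lt_open => //; rewrite /s; lra.
  near=> v; apply: (@lt_trans _ _ s); last by rewrite /s; lra.
  apply: open_lower_graph_lt.
    near: v; exact: (cvgr_gt (rad u) (crad u)).
  near: v; apply: continuous_pt; exact: open_nbhs_nbhs.
have lbd : \forall v \near u, lower_graph u - e < lower_graph v.
  have [rc|cr] := ltP (lower_graph u - e) (- rad u).
    near=> v; apply: lt_le_trans (lower_graph_ge v); rewrite ltrNr; near: v.
    by apply: (cvgr_lt (rad u) (crad u)); rewrite ltrNr.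
  pose s := lower_graph u - e / 2.
  have sr : `|s| < rad u by rewrite ltr_norml /s; lra.
  have Os : ~ closure Omega (pt u s).
    by apply: lower_graph_lt_closure => //; rewrite /s; lra.
  near=> v; apply: (@lt_le_trans _ _ s); first by rewrite /s; lra.
  rewrite leNgt; apply/negP => fvs.
  have : (~` closure Omega) (pt v s).
    near: v; apply: continuous_pt; apply: open_nbhs_nbhs; split=> //.
    exact/closed_openC/closed_closure.
  apply; apply: subset_closure; apply: lower_graph_lt_open fvs.
  near: v; exact: (cvgr_gt (rad u) (crad u)).
near=> v; rewrite ltr_distlC.
by apply/andP; split; near: v.
Unshelve. all: by end_near. Qed.

Lemma upward_local_epigraph : local_epigraph Omega P delta Q lower_graph.
Proof.
apply/local_epigraph_glueP => u s sr.
by split; [exact: open_lower_graph_lt|exact: lower_graph_lt_open].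
Qed.

End lower_graph.
End epigraph.

(** * Averaging good directions *)

Lemma bounded_closure (R : realType) n (A : set 'rV[R]_n) :
  bounded_set A -> bounded_set (closure A).
Proof.
move=> [M [Mr AM]]; exists (M + 1); split; first by rewrite realD.
move=> N MN x clx; have M1 : M < M + 1 by rewrite ltrDl.
apply: le_trans (ltW MN); suff : closed [set y : 'rV[R]_n | `|y| <= M + 1].
  move=> /closure_id E; suff : closure A `<=` [set y | `|y| <= M + 1] by apply.
  by rewrite E; apply: closure_subset => y Ay; exact: AM Ay.
apply: (@closed_comp _ _ (fun y : 'rV[R]_n => `|y|) [set a : R | a <= M + 1]).
  by move=> y _; exact: norm_continuous.
exact: closed_le.
Qed.

Lemma compact_boundary (R : realType) n (A : set 'rV[R]_n) :
  bounded_set A -> compact (boundary A).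
Proof.
move=> /bounded_closure[M [Mr AM]]; apply: bounded_closed_compact.
  by exists M; split=> // N MN x [clx _]; exact: AM MN x clx.
apply: closedI; first exact: closed_closure.
by apply: open_closedC; exact: open_interior.
Qed.

Lemma upward_good_direction (R : realType) m (Omega : set 'rV[R]_m.+1) P
    (delta : R) n0 :
  open Omega -> 0 < delta -> eball P delta `&` boundary Omega !=set0 ->
  unit_sphere n0 -> upward Omega (eball P delta) n0 -> good_direction Omega P n0.
Proof.
move=> oO d0 bd n1 up; exists delta; split=> //; split=> //.
have [Q QQ Qn] := frame_completion n1; rewrite -Qn in up.
exists Q, (lower_graph Omega P delta Q); split=> //.
  exact: continuous_lower_graph.
exact: upward_local_epigraph.
Qed.

Lemma C0_boundary_upward (R : realType) m (Omega : set 'rV[R]_m.+1) P :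
  C0_boundary Omega -> boundary Omega P ->
  exists delta v, 0 < delta /\ upward Omega (eball P delta) v.
Proof.
move=> C0 /C0 [delta [Q [f [d0 QQ cf epi]]]].
exists delta, (row ord_max Q); split=> //.
exact: local_epigraph_upward epi.
Qed.

Lemma positive_lower_bound (R : realType) (I : eqType) (r : seq I) (d : I -> R) :
  (forall i, i \in r -> 0 < d i) ->
  exists2 e, 0 < e & forall i, i \in r -> e <= d i.
Proof.
elim: r => [_|i r IHr d0]; first by exists 1.
have [j jr|e e0 er] := IHr; first by apply: d0; rewrite inE jr orbT.
exists (Num.min e (d i)); first by rewrite lt_min e0 d0// mem_head.
move=> j; rewrite inE => /predU1P[->|/er ej]; first by rewrite ge_min lexx orbT.
by rewrite ge_min ej.
Qed.

Theorem proposition2p1 (R : realType) (m : nat) (Omega : set 'rV[R]_m.+1) :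
  (1 < m.+1)%N ->
  open Omega -> bounded_set Omega -> C0_boundary Omega ->
  exists (U : set 'rV[R]_m.+1) (G : 'rV[R]_m.+1 -> 'rV[R]_m.+1),
    [/\ open U, boundary Omega `<=` U, smooth_on U G,
        (forall P, U P -> unit_sphere (G P))
      & (forall P, U P -> good_direction Omega P (G P))].
Proof.
move=> _ oO bO C0.
have /choice[dv dvP] : forall P, exists dv : R * 'rV[R]_m.+1,
    boundary Omega P -> 0 < dv.1 /\ upward Omega (eball P dv.1) dv.2.
  move=> P; have [bP|nP] := pselect (boundary Omega P); last by exists (0, 0).
  by have [d [v dvP]] := C0_boundary_upward C0 bP; exists (d, v).
(* Half of each radius is kept in reserve: if [x] is within [d i] of [i], the ball of radius
   [e <= d i] about [x] lies in the ball where [(dv i).2] is upward. *)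
pose d P := (dv P).1 / 2.
have d0 P : boundary Omega P -> 0 < d P by move=> /dvP[? _]; rewrite divr_gt0.
have := compact_boundary bO; rewrite compact_cover.
move=> /(_ _ (boundary Omega) (fun P => eball P (d P))).
case=> [P _|P bP|D Dsub Dcov]; first exact: open_eball.
  by exists P => //; exact/eballxx/d0.
have bD i : i \in enum_fset D -> boundary Omega i.
  by move=> iD; exact: set_mem (Dsub i iD).
have [e e0 eP] : exists2 e, 0 < e & forall i, i \in enum_fset D -> e <= d i.
  by apply: positive_lower_bound => i /bD/d0.
(* A bump that is positive exactly on [eball i (d i)]; squared distances keep its argument
   polynomial. *)
pose psi i (x : 'rV[R]_m.+1) : R :=
  flat 0 (d i ^+ 2 - \sum_k (x - i) ord0 k ^+ 2).
(* The first union makes the ball of radius [e] about each point of [U] meet the boundary; the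
   second makes at least one weight positive. *)
pose U := (\bigcup_(Q in boundary Omega) eball Q e) `&`
  (\bigcup_(i in [set` D]) eball i (d i)).
pose V x := \sum_(i <- enum_fset D) psi i x *: (dv i).2.
pose N x := \sum_j (V x ord0 j) ^+ 2.
have oU : open U.
  by apply: openI; apply: bigcup_open => i _; exact: open_eball.
have psi_ball i x : i \in enum_fset D -> (0 < psi i x) = (enorm (x - i) < d i).
  move=> /bD/d0 di; rewrite /psi -dotxxE -sqr_enorm.
  have [h|h] := ltP 0 (d i ^+ 2 - enorm (x - i) ^+ 2).
    rewrite flat_gt0//; apply/esym.
    by rewrite -(@ltr_pXn2r _ 2)// ?nnegrE ?enorm_ge0 ?(ltW di)// -subr_gt0.
  rewrite flat_le0// ltxx; apply/esym/negbTE; rewrite -leNgt.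
  by rewrite -(@ler_pXn2r _ 2)// ?nnegrE ?enorm_ge0 ?(ltW di)// -subr_le0.
have upV x : U x -> upward Omega (eball x e) (V x).
  move=> [_ [i0 /= i0D xi0]]; apply: upward_sum.
  - by move=> i _; exact: flat_ge0.
  - move=> i iD; rewrite psi_ball// => xi.
    have [_] := dvP i (bD i iD); apply: upward_sub => y /= yx.
    apply: le_lt_trans (enorm_triangle x _ _) _.
    rewrite (splitr (dv i).1) ltrD//.
    exact: lt_le_trans yx (eP i iD).
  - by exists i0; rewrite ?psi_ball.
have bdU x : U x -> eball x e `&` boundary Omega !=set0.
  by move=> [[Q bQ xQ] _]; exists Q; split=> //; rewrite /eball /= enormB.
have N0 x : U x -> 0 < N x.
  move=> Ux; rewrite /N -dotxxE lt_neqAle dotxx_ge0 andbT eq_sym dotxx_eq0.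
  exact: upward_neq0 oO (bdU x Ux) (upV x Ux).
(* Dividing by the norm is written as a real power of the squared norm [N], positive on [U], to fit
   [flat_expr_powR]. *)
pose G x := \row_j (N x `^ (- 2^-1) * V x ord0 j).
have GE x : G x = (N x `^ (- 2^-1)) *: V x by apply/rowP => j; rewrite !mxE.
have G1 x : U x -> unit_sphere (G x).
  move=> Ux; rewrite /unit_sphere /= GE enormZ ger0_norm ?powR_ge0// enormE.
  rewrite dotxxE -/(N x) -powR12_sqrt ?(ltW (N0 x Ux))// powRN mulVf//.
  by rewrite gt_eqF// powR_gt0// N0.
exists U, G; split=> //.
- move=> P bP; split; first by exists P => //; exact: eballxx.
  by have [i iD Pi] := Dcov P bP; exists i.
- apply: smooth_row_flat_expr => // j.
  have eV k : flat_expr U (fun x => V x ord0 k).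
    have -> : (fun x => V x ord0 k) =
        (fun x => \sum_(i <- enum_fset D) (psi i * cst ((dv i).2 ord0 k)) x).
      apply/funext => x; rewrite /V summxE.
      by apply: eq_bigr => i _; rewrite mxE.
    apply: flat_expr_sum => i; apply: flat_expr_mul; last exact: flat_expr_cst.
    apply: (flat_expr_flat 0 (f := fun x =>
      d i ^+ 2 - \sum_k (x - i) ord0 k ^+ 2)).
    have -> : (fun x : 'rV[R]_m.+1 => d i ^+ 2 - \sum_l (x - i) ord0 l ^+ 2) =
        cst (d i ^+ 2) + cst (-1) * (fun x => \sum_l
          (((fun x : 'rV[R]_m.+1 => x ord0 l) + cst (- i ord0 l)) *
           ((fun x => x ord0 l) + cst (- i ord0 l))) x).
      apply/funext => x; rewrite !fctE /= mulN1r; congr (_ - _).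
      by apply: eq_bigr => l _; rewrite !mxE expr2.
    apply: flat_expr_add; first exact: flat_expr_cst.
    apply: flat_expr_mul; first exact: flat_expr_cst.
    apply: flat_expr_sum => l; apply: flat_expr_mul;
      by apply: flat_expr_add; [exact: flat_expr_coord|exact: flat_expr_cst].
  have eN : flat_expr U N.
    by apply: flat_expr_sum => k; exact: flat_expr_mul.
  apply: flat_expr_mul => //; exact: flat_expr_powR.
- move=> x Ux; apply: (upward_good_direction oO e0 (bdU x Ux) (G1 x Ux)).
  by rewrite GE; apply: upwardZ (upV x Ux); exact: powR_gt0 (N0 x Ux).
Qed.
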